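(* Let $M=p_1^{n_1}\cdots p_d^{n_d}$, where $p_1,\dots,p_d$ are distinct primes and $n_1,\dots,n_d\in\mathbb{N}$. Let $A\oplus B=\mathbb{Z}_M$ be a tiling, and assume that $$p_d>\max\Big( (|A|,M/p_d^{n_d}),\ (|B|,M/p_d^{n_d})\Big).$$ Then there exists $i\in\{1,\dots,d\}$ such that $M/p_i\in\mathrm{Div}(A)\cup\mathrm{Div}(B)$.
   Context: For $m,n\in\mathbb{Z}$, $(m,n)$ denotes their greatest common divisor. For $A,B\subset\mathbb{Z}_M$, $A\oplus B=\mathbb{Z}_M$ (a tiling) means every element of $\mathbb{Z}_M$ can be written uniquely as $a+b\bmod M$ with $a\in A$, $b\in B$. The divisor set is $\mathrm{Div}(A)=\{(a-a',M): a,a'\in A\}$ (with elements of $\mathbb{Z}_M$ represented by integers). *)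

(* Defs.v *)
From HB Require Import structures.
From mathcomp Require Import all_boot all_order all_algebra.
Set Implicit Arguments.
Unset Strict Implicit.
Unset Printing Implicit Defensive.
Import GRing.Theory.

(* 'Z_M is the ring of integers modulo M only when 1 < M; the definitions     *)
(* below are meant to be used under that condition.                           *)

Definition tiling (M : nat) (A B : {set 'Z_M}) : Prop :=
  forall x : 'Z_M, exists! ab : 'Z_M * 'Z_M,
    [/\ ab.1 \in A, ab.2 \in B & x = (ab.1 + ab.2)%R].

(* The difference a - a' is taken in 'Z_M and then read as its representative *)
(* in {0, ..., M - 1}; the gcd with M does not depend on the representative.  *)
(* Since gcdn 0 M = M, the number M lies in Div A for every nonempty A.       *)
Definition Div (M : nat) (A : {set 'Z_M}) : {pred nat} :=
  [pred m : nat | [exists a in A, exists a' in A,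
     m == gcdn (nat_of_ord (a - a')%R) M]].

(* Main.v *)
Require Import Defs.
From HB Require Import structures.
From mathcomp Require Import all_boot all_order all_algebra.
From mathcomp Require Import all_field ring.

(* The index i = d always works. Write p = p_d, n = n_d, N = M / p^n and       *)
(* K = M / p, and decompose the fiber k K = a_k + b_k for 0 <= k < p. By      *)
(* Sands' theorem, a_k - a_l and b_k - b_l have the same gcd with M only if   *)
(* both vanish, which forces a_k = a_l or b_k = b_l mod p^n for all k, l.     *)
(* Congruence mod p^n being transitive, one of the two families, say (b_k),   *)
(* lies in a single class mod p^n. That class has at most gcd(|B|, N) < p     *)
(* elements of B, because each cyclotomic polynomial of order p^s, s <= n,    *)
(* divides the mask polynomial of A or of B; so b_k = b_l for some k <> l,    *)
(* and then a_k - a_l = (k - l) K.                                            *)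

Set Implicit Arguments.
Unset Strict Implicit.
Unset Printing Implicit Defensive.
Import GRing.Theory.

(** Exponential sums supply both arithmetic inputs. For a tiling, the mask polynomials satisfy
    A(z)B(z) = 0 at every M-th root of unity z other than 1, and whether A(z) vanishes depends only
    on the order of z ([expsum_conj]). Hence dilating a tile by a unit preserves the tiling, which
    gives [sands]; and vanishing at order p^s spreads a tile evenly over residue classes, which
    gives [tiling_card_residue_class]. [tiling_fiber_dichotomy] turns [sands] into the alternative
    of congruences, and [fiber_Div] is the final pigeonhole. *)

(** * Arithmetic in ['Z_M] *)

Lemma val_ZpD M (M_gt1 : 1 < M) (x y : 'Z_M) : (x + y)%R = (x + y) %% M :> nat.
Proof. by case: M M_gt1 x y => [|[|m]]. Qed.

Lemma val_ZpM M (M_gt1 : 1 < M) (x y : 'Z_M) : (x * y)%R = (x * y) %% M :> nat.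
Proof. by case: M M_gt1 x y => [|[|m]]. Qed.

Lemma val_inZp M (M_gt1 : 1 < M) k : (inZp k : 'Z_M) = k %% M :> nat.
Proof. by case: M M_gt1 => [|[|m]]. Qed.

(** Dividing x, y and M by g leaves x' and y' prime to m = M/g. The quotient y'/x' is a unit mod m,
    and units mod m lift to units mod M. *)
Lemma gcdn_eq_unit M (M_gt1 : 1 < M) (x y : 'Z_M) : gcdn x M = gcdn y M ->
  exists2 u : 'Z_M, coprime u M & y = (u * x)%R.
Proof.
move=> eq_g; set g := gcdn x M; have M_gt0 := ltnW M_gt1.
have g_gt0 : 0 < g by rewrite gcdn_gt0 M_gt0 orbT.
have [x' def_x] := dvdnP (dvdn_gcdl x M : g %| x).
have [y' def_y] : exists y', y = (y' * g) :> nat.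
  by apply/dvdnP; rewrite /g eq_g dvdn_gcdl.
have [m def_M] := dvdnP (dvdn_gcdr x M : g %| M).
have co_x : coprime m x'.
  by rewrite coprime_sym /coprime -(eqn_pmul2r g_gt0) muln_gcdl mul1n -def_x -def_M.
have co_y : coprime m y'.
  rewrite coprime_sym /coprime -(eqn_pmul2r g_gt0) muln_gcdl mul1n -def_y -def_M.
  by rewrite -eq_g.
(* A multiple of x' that is 1 mod m: c is the inverse of x' mod m. *)
have [c def_c] : exists c, chinese m x' 1 0 = (c * x').
  by apply/dvdnP; rewrite /dvdn chinese_modr // mod0n.
have c_inv : (c * x') = 1%N %[mod m] by rewrite -def_c chinese_modl.
have co_c : coprime m c.
  have := coprime_modr m (c * x'); rewrite c_inv coprime_modr coprimen1.
  by rewrite coprimeMr => /esym/andP[].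
set v := (c * y'); have co_v : coprime m v by rewrite coprimeMr co_c.
(* With t the part of M prime to v, v + t * m is prime to M.                  *)
set t := M`_[pred q : nat | ~~ (q %| v)]; set w := (v + t * m).
have co_w : coprime w M.
  apply: contraT => not_co; have := pdiv_prime (_ : 1 < gcdn w M).
  rewrite ltn_neqAle eq_sym not_co gcdn_gt0 M_gt0 orbT => /(_ isT).
  have := pdiv_dvd (gcdn w M); set q := pdiv _.
  rewrite dvdn_gcd => /andP[q_w q_M] q_pr.
  (* If q divides v, then q divides neither t nor m; otherwise q, a prime factor of M, divides t but
     not v. Either way q cannot divide w. *)
  have [q_v | q_v] := boolP (q %| v).
    move: q_w; rewrite dvdn_addr // Euclid_dvdM // => /orP[q_t | q_m].
      have q_pi : q \in \pi(t) by rewrite mem_primes q_pr part_gt0.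
      by have := pnatPpi (part_pnat _ M) q_pi; rewrite inE q_v.
    have : (q %| gcdn m v) by rewrite dvdn_gcd q_m.
    by rewrite (eqP co_v) Euclid_dvd1.
  have q_t : (q %| t).
    by rewrite -(@part_pnat_id [pred q : nat | ~~ (q %| v)] q) ?partn_dvd ?pnatE.
  by move: q_w; rewrite dvdn_addl ?(negPf q_v) // dvdn_mulr.
exists (inZp w); first by rewrite val_inZp // coprime_modl.
have def_wx : w * x = t * x' * M + y' * (c * x') * g.
  by rewrite def_x [in RHS]def_M /w /v; ring.
apply: ord_inj; rewrite val_ZpM // val_inZp // modnMml def_wx modnMDl.
rewrite [in RHS]def_M -muln_modl -modnMmr c_inv modnMmr muln1 muln_modl -def_M -def_y.
by rewrite modn_small // -[ltnRHS](Zp_cast M_gt1).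
Qed.

(** * Fourier analysis on ['Z_M] *)

Section ExponentialSums.
Local Open Scope ring_scope.
Variables (M : nat).
Hypothesis M_gt1 : (1 < M)%N.
Implicit Types (A B : {set 'Z_M}) (z w : algC).

Lemma exprZpD z (x y : 'Z_M) :
  z ^+ M = 1 -> z ^+ (x + y)%R = z ^+ x * z ^+ y.
Proof. by move=> zM1; rewrite (val_ZpD M_gt1) expr_mod // exprD. Qed.

Lemma exprZpM z (x y : 'Z_M) :
  z ^+ M = 1 -> z ^+ (x * y)%R = (z ^+ x) ^+ y.
Proof. by move=> zM1; rewrite (val_ZpM M_gt1) expr_mod // exprM. Qed.

(** The values of g are the coefficients of a polynomial of size at most M that vanishes at M
    distinct roots of unity. *)
Lemma fourier_inj (g : 'Z_M -> algC) :
  (forall z, z ^+ M = 1 -> \sum_x g x * z ^+ (x : nat) = 0) ->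
  forall x, g x = 0.
Proof.
case: M M_gt1 g => [|[|m]] // _ g g_hat0 x.
have [w w_prim] := C_prim_root_exists (isT : (0 < m.+2)%N).
set P := \poly_(i < m.+2) g (inord i).
have P_coef (i : 'I_m.+2) : P`_i = g i by rewrite coef_poly ltn_ord inord_val.
suff P0 : P = 0 by rewrite -(P_coef x) P0 coef0.
have w_uniq : uniq [seq w ^+ i | i : 'I_m.+2].
  rewrite map_inj_uniq ?enum_uniq // => i j /eqP.
  by rewrite (eq_prim_root_expr w_prim) !modn_small // => /eqP/val_inj.
apply: roots_geq_poly_eq0 w_uniq _; last by rewrite size_map size_enum_ord size_poly.
apply/allP=> _ /mapP[j _ ->]; apply/eqP.
rewrite horner_poly -[RHS](g_hat0 (w ^+ (j : nat))).
  by apply: eq_bigr => i _; rewrite inord_val.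
by rewrite exprAC (prim_expr_order w_prim) expr1n.
Qed.

(* Replacing x by x + t multiplies the sum by z^t.                            *)
Lemma expsum_periodic0 (g : 'Z_M -> algC) (t : 'Z_M) z :
  z ^+ M = 1 -> z ^+ t != 1 -> (forall x, g (x + t)%R = g x) ->
  \sum_x g x * z ^+ (x : nat) = 0.
Proof.
move=> zM1 zt_neq1 g_per; apply/eqP; move: zt_neq1; apply: contraNT => S_neq0.
rewrite -subr_eq0 -(mulIr_eq0 _ (mulIf S_neq0)) mulrBl mul1r subr_eq0 eq_sym.
rewrite {1}(reindex_inj (addIr t)) /= mulr_sumr; apply/eqP/eq_bigr => x _.
by rewrite g_per exprZpD // [_ ^+ x * _]mulrC mulrCA.
Qed.

Definition expsum A z := \sum_(a in A) z ^+ (a : nat).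

(** The mask polynomial is rational, and z and w have the same minimal polynomial over the
    rationals, the m-th cyclotomic one. *)
Lemma expsum_conj A z w m :
  m.-primitive_root z -> m.-primitive_root w -> expsum A z = 0 -> expsum A w = 0.
Proof.
move=> z_prim w_prim.
have expsumE y : expsum A y = (map_poly ratr (\sum_(a in A) 'X^a)).[y].
  rewrite rmorph_sum /= horner_sum; apply: eq_bigr => a _.
  by rewrite map_polyXn hornerXn.
have [P [minz _] rootz] := minCpolyP z; have [Q [minw _] rootw] := minCpolyP w.
have eqPQ : P = Q.
  apply: (@map_poly_inj _ _ (ratr : {rmorphism rat -> algC})) => /=.
  rewrite -minz -minw (minCpoly_cyclotomic z_prim) (minCpoly_cyclotomic w_prim).
  by rewrite -(Cintr_Cyclotomic z_prim) -(Cintr_Cyclotomic w_prim).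
rewrite !expsumE => /eqP; rewrite -[_ == 0]/(root _ z) rootz => dvdP.
by apply/eqP; rewrite -[_ == 0]/(root _ w) rootw -eqPQ.
Qed.

(** * Tilings and Sands' theorem *)

Lemma tiling_inj A B a b a' b' : tiling A B ->
  a \in A -> b \in B -> a' \in A -> b' \in B -> a + b = a' + b' ->
  a = a' /\ b = b'.
Proof.
move=> tAB aA bB aA' bB' eq_ab; have [ab [_ ab_uniq]] := tAB (a + b).
by have := ab_uniq (a, b) (And3 aA bB erefl);
   rewrite (ab_uniq (a', b') (And3 aA' bB' eq_ab)) => -[-> ->].
Qed.

Lemma tiling_sym A B : tiling A B -> tiling B A.
Proof.
move=> tAB x; have [[a b] [/= [aA bB ->] ab_uniq]] := tAB x.
exists (b, a); split=> [|[b' a'] [/= bB' aA' eq_ab]]; first by rewrite addrC.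
by have [-> ->] := tiling_inj tAB aA bB aA' bB' (etrans eq_ab (addrC _ _)).
Qed.

Lemma tiling_sum (V : nmodType) A B (F : 'Z_M -> V) : tiling A B ->
  \sum_(a in A) \sum_(b in B) F (a + b) = \sum_x F x.
Proof.
move=> tAB; rewrite pair_big (partition_big (fun ab => ab.1 + ab.2) predT) //=.
apply: eq_bigr => x _; have [[a b] [/= [aA bB ->] ab_uniq]] := tAB x.
rewrite (big_pred1 (a, b)) // => -[a' b'] /=.
apply/idP/eqP => [/andP[/andP[aA' bB'] /eqP eq_ab] | [-> ->]].
  by rewrite (ab_uniq (a', b')).
by rewrite aA bB eqxx.
Qed.

Lemma card_tiling A B : tiling A B -> (#|A| * #|B|)%N = M.
Proof.
move=> tAB; have := @tiling_sum nat A B (fun=> 1%N) tAB.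
rewrite sum1_card sum_nat_const => ->.
by rewrite sum1_card -[RHS](Zp_cast M_gt1) -[RHS]card_ord; apply: eq_card.
Qed.

Lemma sum_exprZp z : z ^+ M = 1 -> z != 1 -> \sum_(x : 'Z_M) z ^+ x = 0.
Proof.
move=> zM1 z_neq1; rewrite (eq_bigr (fun x : 'Z_M => 1 * z ^+ x)) => [|x _].
  by apply: (@expsum_periodic0 (fun=> 1) 1).
by rewrite mul1r.
Qed.

Lemma tiling_expsum A B z : tiling A B -> z ^+ M = 1 -> z != 1 ->
  expsum A z * expsum B z = 0.
Proof.
move=> tAB zM1 /(sum_exprZp zM1) <-.
rewrite -(tiling_sum (fun x : 'Z_M => z ^+ x) tAB) mulr_suml.
apply: eq_bigr => a _; rewrite mulr_sumr.
by apply: eq_bigr => b _; rewrite exprZpD.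
Qed.

(* Dilating a tile by a unit permutes its vanishing exponential sums, so the  *)
(* dilate tiles with the same complement.                                     *)
Lemma tiling_dilate_inj A B (u a b a' b' : 'Z_M) : tiling A B -> coprime u M ->
  a \in A -> b \in B -> a' \in A -> b' \in B -> u * a + b = u * a' + b' ->
  a = a' /\ b = b'.
Proof.
move=> tAB u_co aA bB aA' bB' eq_ab.
pose fib x := [set ab in setX A B | u * ab.1 + ab.2 == x].
(* c counts the representations of x as u a + b; Fourier inversion shows that it is constantly 1. *)
pose c x : algC := #|fib x|%:R.
have c_hat z : \sum_x c x * z ^+ (x : nat) =
    \sum_(a in A) \sum_(b in B) z ^+ (u * a + b)%R.
  rewrite pair_big (partition_big (fun ab => u * ab.1 + ab.2) predT) //=.
  apply: eq_bigr => x _; rewrite /c -sum1_card natr_sum mulr_suml.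
  apply: eq_big => [[a1 b1]|[a1 b1]]; first by rewrite !inE.
  by rewrite !inE /= => /andP[_ /eqP<-]; rewrite mul1r.
have /(_ (u * a + b)) : forall x, c x - 1 = 0.
  apply: fourier_inj => z zM1.
  rewrite (eq_bigr _ (fun _ _ => mulrBl _ _ _)) sumrB c_hat.
  have [-> | z_neq1] := eqVneq z 1.
    have /= := congr1 (fun k => k%:R : algC) (tiling_sum (fun=> 1%N) tAB).
    rewrite natr_sum => eq1; apply/eqP; rewrite subr_eq0; apply/eqP.
    transitivity (\sum_(a in A) (\sum_(b in B) 1%N)%:R : algC).
      apply: eq_bigr => a1 _; rewrite natr_sum.
      by apply: eq_bigr => b1 _; rewrite expr1n.
    by rewrite eq1 natr_sum; apply: eq_bigr => x _; rewrite expr1n mul1r.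
  rewrite (eq_bigr _ (fun _ _ => mul1r _)) sum_exprZp // subr0.
  transitivity (expsum A (z ^+ u) * expsum B z).
    rewrite mulr_suml; apply: eq_bigr => a1 _; rewrite mulr_sumr.
    by apply: eq_bigr => b1 _; rewrite exprZpD // exprZpM.
  (* As u is prime to M, z^u has the same order as z, so A(z) = 0 implies A(z^u) = 0. *)
  have [m z_prim m_dvd] := prim_order_exists (ltnW M_gt1) zM1.
  have /eqP := tiling_expsum tAB zM1 z_neq1; rewrite mulf_eq0.
  case/orP=> /eqP; last by move->; rewrite mulr0.
  move/(expsum_conj z_prim) => ->; first by rewrite mul0r.
  by rewrite prim_root_exp_coprime // (coprime_dvdr m_dvd).
move/eqP; rewrite subr_eq0 (Num.Theory.eqr_nat _ _ 1) => /eqP card1.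
have /card_le1_eqP fib1 : (#|fib (u * a + b)%R| <= 1)%N by rewrite card1.
suff [-> ->] : (a', b') = (a, b) by [].
by apply: fib1; rewrite !inE ?aA ?bB ?aA' ?bB' ?eq_ab ?eqxx.
Qed.

(** Equal gcds give b - b' = u (a - a') with u a unit, so u a + b' = u a' + b are two
    representations in the dilated tiling. *)
Lemma sands A B a b a' b' : tiling A B ->
  a \in A -> b \in B -> a' \in A -> b' \in B ->
  gcdn (a - a')%R M = gcdn (b - b')%R M -> a = a' /\ b = b'.
Proof.
move=> tAB aA bB aA' bB' /(gcdn_eq_unit M_gt1)[u u_co eq_u].
suff [-> ->] : a = a' /\ b' = b by [].
apply: (tiling_dilate_inj tAB u_co) => //.
by rewrite -[b](subrK b') eq_u mulrBr addrA [u * a' + _]addrC subrK.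
Qed.

End ExponentialSums.

(** * Distribution of a tile in residue classes *)

Section ResidueClasses.
Variables (M : nat).
Hypothesis M_gt1 : 1 < M.
Implicit Types (A B : {set 'Z_M}) (q x : nat).

Definition residue_class A q x := [set a in A | nat_of_ord a == x %[mod q]].

Lemma eq_residue_class A q x y :
  x = y %[mod q] -> residue_class A q x = residue_class A q y.
Proof. by move=> eq_xy; apply/setP=> a; rewrite !inE eq_xy. Qed.

Lemma residue_class1 A x : residue_class A 1 x = A.
Proof. by apply/setP=> a; rewrite inE !modn1 eqxx andbT. Qed.

Lemma residue_class_ZpD A q (x t : 'Z_M) : q %| M ->
  residue_class A q (x + t)%R = residue_class A q (x + t).
Proof. by move=> qM; apply: eq_residue_class; rewrite val_ZpD // modn_dvdm. Qed.

Lemma card_residue_class_split A q p x : 0 < p -> x < q ->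
  #|residue_class A q x| = \sum_(k < p) #|residue_class A (q * p) (x + k * q)|.
Proof.
move=> p_gt0 lt_xq; have q_gt0 := leq_ltn_trans (leq0n x) lt_xq.
(* The next digit in base p: it selects the class mod q p inside a class mod q. *)
pose digit (a : 'Z_M) : 'I_p := Ordinal (ltn_pmod (a %/ q) p_gt0).
rewrite -sum1_card (partition_big digit predT) //=; apply: eq_bigr => k _.
rewrite -sum1_card; apply: eq_bigl => a; rewrite !inE -andbA; congr (_ && _).
rewrite (modn_small lt_xq) -val_eqE /= modn_divl.
rewrite (@modn_small (x + k * q)); last first.
  by rewrite [q * p]mulnC -ltn_divLR // addnC divnMDl // (divn_small lt_xq) addn0.
rewrite -(modn_dvdm a (dvdn_mulr p (dvdnn q))) [p * q]mulnC.
set b := a %% _; apply/andP/eqP => [[/eqP b_mod /eqP b_div] | ->].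
  by rewrite [b](divn_eq b q) b_mod b_div addnC.
by rewrite addnC modnMDl (modn_small lt_xq) divnMDl // (divn_small lt_xq) addn0.
Qed.

Section Fourier.
Local Open Scope ring_scope.

Lemma class_expsum_periodic A q z : (q %| M)%N -> z ^+ M = 1 -> z ^+ q != 1 ->
  \sum_(x : 'Z_M) #|residue_class A q x|%:R * z ^+ x = 0 :> algC.
Proof.
move=> qM zM1 zq; apply: (@expsum_periodic0 _ M_gt1 _ (inZp q)) => // [|x].
  by rewrite val_inZp // expr_mod.
rewrite residue_class_ZpD // val_inZp //; congr _%:R; congr #|pred_of_set _|.
by apply: eq_residue_class; rewrite -modnDmr modn_dvdm // modnn addn0.
Qed.

(** The class sizes are the convolution of the indicator of A with that of the multiples of q, so
    A(z) factors out of their transform. *)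
Lemma class_expsum0 A q z : (q %| M)%N -> z ^+ M = 1 -> expsum A z = 0 ->
  \sum_(x : 'Z_M) #|residue_class A q x|%:R * z ^+ x = 0 :> algC.
Proof.
move=> qM zM1 A0.
transitivity (\sum_(x : 'Z_M) \sum_(a in A | (a == x %[mod q])%N) z ^+ x).
  apply: eq_bigr => x _; rewrite -sum1_card natr_sum mulr_suml.
  by apply: eq_big => [a|a _]; rewrite ?inE ?mul1r.
rewrite (exchange_big_dep (fun a => a \in A)) /=; last by move=> x a _ /andP[].
transitivity (expsum A z * \sum_(h : 'Z_M | (q %| h)%N) z ^+ h); last first.
  by rewrite A0 mul0r.
rewrite mulr_suml.
apply: eq_bigr => a aA; rewrite (reindex_inj (addrI a)) mulr_sumr.
apply: eq_big => [h|h _]; last by rewrite exprZpD.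
rewrite aA val_ZpD // (modn_dvdm _ qM) -[X in (X %% _ == _)%N]addn0.
by rewrite eqn_modDl mod0n eq_sym.
Qed.

(** The difference of the class sizes and their translate by p^s has zero transform at every z: the
    factor 1 - z^(p^s) vanishes, or z^q is not 1 and periodicity applies, or z has order exactly
    p^(s+1) and A(z) = 0 by conjugacy with w. *)
Lemma residue_class_shift A p s w x :
  prime p -> (p ^ s.+1 %| M)%N -> (p ^ s.+1).-primitive_root w ->
  expsum A w = 0 ->
  #|residue_class A (p ^ s.+1) (x + p ^ s)| = #|residue_class A (p ^ s.+1) x|.
Proof.
move=> p_pr qM w_prim Aw0; set q := (p ^ s.+1)%N in qM w_prim *.
pose t : 'Z_M := inZp (p ^ s).
pose g (y : 'Z_M) : algC :=
  #|residue_class A q (y + t)%R|%:R - #|residue_class A q y|%:R.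
have /(_ (inZp x)) : forall y, g y = 0.
  apply: fourier_inj => // z zM1.
  have z_neq0 : z ^+ t != 0.
    rewrite expf_neq0 // -unitfE; apply/unitrPr; exists (z ^+ M.-1).
    by rewrite -exprS prednK // ltnW.
  set T := \sum_(y : 'Z_M) #|residue_class A q y|%:R * z ^+ y.
  have g_hat : (\sum_y g y * z ^+ (y : nat)) * z ^+ t = (1 - z ^+ t) * T.
    rewrite (eq_bigr _ (fun _ _ => mulrBl _ _ _)) sumrB mulrBl mulrBl mul1r.
    congr (_ - _); last by rewrite mulrC.
    rewrite mulr_suml [T](reindex_inj (addIr t)).
    by apply: eq_bigr => y _; rewrite exprZpD // mulrA.
  apply: (mulIf z_neq0); rewrite mul0r g_hat.
  have zt : z ^+ t = z ^+ (p ^ s) by rewrite val_inZp // expr_mod.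
  have [zps | zps] := eqVneq (z ^+ (p ^ s)) 1; first by rewrite zt zps subrr mul0r.
  rewrite [T](_ : _ = 0) ?mulr0 //.
  have [zq | zq] := eqVneq (z ^+ q) 1; last exact: class_expsum_periodic.
  apply: class_expsum0 => //; apply: (expsum_conj w_prim) Aw0.
  have q_gt0 : (0 < q)%N by rewrite expn_gt0 prime_gt0.
  have [m z_prim /(dvdn_pfactor _ _ p_pr)[k le_ks def_m]] := prim_order_exists q_gt0 zq.
  move: z_prim; rewrite {}def_m; move: le_ks; rewrite leq_eqVlt ltnS.
  case/predU1P=> [-> // | le_ks z_prim]; case/negP: zps.
  by rewrite -(prim_order_dvd z_prim) dvdn_exp2l.
move/eqP; rewrite subr_eq0 Num.Theory.eqr_nat => /eqP.
rewrite residue_class_ZpD // !val_inZp // => eq_c.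
rewrite (@eq_residue_class A q (x + _) (x %% M + (p ^ s) %% M)%N).
  by rewrite eq_c (@eq_residue_class A q (x %% M)%N x) // modn_dvdm.
by rewrite -[RHS]modnDm !(modn_dvdm _ qM) modnDm.
Qed.
End Fourier.

(** * Counting down the tree of classes mod p^s *)

Section Tree.
Variables (A : {set 'Z_M}) (p n : nat) (e : pred nat).
Hypothesis p_gt0 : 0 < p.
Hypothesis eA : forall s x, s < n -> e s ->
  #|residue_class A (p ^ s.+1) (x + p ^ s)| = #|residue_class A (p ^ s.+1) x|.

Lemma residue_class_equidistr s x : s < n -> e s ->
  #|residue_class A (p ^ s) x| = p * #|residue_class A (p ^ s.+1) x|.
Proof.
move=> lt_sn es; have ps_gt0 : 0 < p ^ s by rewrite expn_gt0 p_gt0.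
have shift y k : #|residue_class A (p ^ s.+1) (y + k * p ^ s)|
               = #|residue_class A (p ^ s.+1) y|.
  by elim: k => [|k IHk]; rewrite ?addn0 // mulSnr addnA eA.
rewrite -(@eq_residue_class _ _ (x %% p ^ s)) ?modn_mod //.
rewrite (@card_residue_class_split _ _ p) ?ltn_pmod // -expnSr.
rewrite (eq_bigr _ (fun (k : 'I_p) _ => shift _ k)) sum_nat_const card_ord.
by rewrite -(shift (x %% p ^ s) (x %/ p ^ s)) addnC -divn_eq.
Qed.

(** Climbing from level t to the root, a level in e multiplies the common divisor by p; at any other
    level it still divides the sum over the children. *)
Lemma dvdn_card_of_classes t m : t <= n ->
  (forall x, m %| #|residue_class A (p ^ t) x|) ->
  m * p ^ (\sum_(s < t) e s) %| #|A|.
Proof.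
elim: t m => [|t IHt] m lt_tn m_dvd.
  by rewrite big_ord0 muln1 -(residue_class1 A 0) m_dvd.
rewrite big_ord_recr /= addnC expnD mulnA; apply: IHt (ltnW lt_tn) _ => x.
have [et | _] := boolP (e t).
  by rewrite residue_class_equidistr // mulnC dvdn_pmul2l.
rewrite muln1 -(@eq_residue_class _ _ (x %% p ^ t)) ?modn_mod //.
rewrite (@card_residue_class_split _ _ p) ?ltn_pmod ?expn_gt0 ?p_gt0 // -expnSr.
by apply: dvdn_sum => k _.
Qed.

(** A class is p times smaller than its parent at a level in e, and never larger than it
    elsewhere. *)
Lemma card_residue_class_le t x : t <= n ->
  #|residue_class A (p ^ t) x| * p ^ (\sum_(s < t) e s) <= #|A|.
Proof.
elim: t => [|t IHt] lt_tn; first by rewrite big_ord0 muln1 residue_class1.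
apply: leq_trans (IHt (ltnW lt_tn)); rewrite big_ord_recr /= addnC expnD mulnA.
rewrite leq_mul2r; apply/orP; right; have [et | _] := boolP (e t).
  by rewrite (residue_class_equidistr x lt_tn et) mulnC.
rewrite muln1 subset_leq_card //; apply/subsetP => a; rewrite !inE.
case/andP=> -> /eqP eq_a; apply/eqP.
by rewrite -(modn_dvdm a (dvdn_exp2l p (leqnSn t))) eq_a modn_dvdm // dvdn_exp2l.
Qed.

End Tree.

(* Each cyclotomic polynomial of order p^s, 0 < s <= n, divides one of the    *)
(* two mask polynomials; at those levels the mass of the tile is divided      *)
(* evenly in p, and comparing with #|A| * #|B| = p^n * N leaves at most a     *)
(* common divisor of #|A| and N for each class mod p^n.                       *)
Lemma tiling_card_residue_class A B p n N x : tiling A B -> prime p ->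
  M = p ^ n * N -> #|residue_class A (p ^ n) x| <= gcdn #|A| N.
Proof.
move=> tAB p_pr defM; have p_gt0 := prime_gt0 p_pr; have M_gt0 := ltnW M_gt1.
have pos s : 0 < p ^ s.+1 by rewrite expn_gt0 p_gt0.
pose w s := sval (C_prim_root_exists (pos s)).
have w_prim s : ((p ^ s.+1).-primitive_root (w s))%R.
  exact: (svalP (C_prim_root_exists (pos s))).
pose e (C : {set 'Z_M}) s := expsum C (w s) == 0%R.
have q_dvd s : s < n -> p ^ s.+1 %| M.
  by move=> lt_sn; rewrite defM dvdn_mulr // dvdn_exp2l.
have shift C s y : s < n -> e C s ->
    #|residue_class C (p ^ s.+1) (y + p ^ s)| = #|residue_class C (p ^ s.+1) y|.
  by move=> lt_sn /eqP; apply: residue_class_shift p_pr (q_dvd s lt_sn) (w_prim s).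
have card_dvd C : p ^ (\sum_(s < n) e C s) %| #|C|.
  by rewrite -[_ ^ _]mul1n (dvdn_card_of_classes p_gt0 (shift C)).
have [u def_u] := dvdnP (card_dvd A); have [v def_v] := dvdnP (card_dvd B).
have e_sum : n <= \sum_(s < n) e A s + \sum_(s < n) e B s.
  rewrite -big_split -[X in X <= _]card_ord -sum1_card leq_sum // => s _.
  have wM1 : (w s ^+ M = 1)%R.
    by apply/eqP; rewrite -(prim_order_dvd (w_prim s)) q_dvd.
  have w_neq1 : (w s != 1)%R.
    by rewrite -[w s]expr1 -(prim_order_dvd (w_prim s)) gtnNdvd //
      -[1](expn0 p) ltn_exp2l // prime_gt1.
  have /eqP := tiling_expsum M_gt1 tAB wM1 w_neq1; rewrite mulf_eq0.
  by rewrite -[_ == _]/(e A s) -[X in _ || X]/(e B s); case: (e A s); case: (e B s).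
(* The powers of p split off from |A| and |B| together contain p^n, so p^n u divides |A||B| = p^n
   N. *)
have u_dvdN : u %| N.
  rewrite -(@dvdn_pmul2l (p ^ n)) ?expn_gt0 ?p_gt0 // -defM -(card_tiling M_gt1 tAB).
  rewrite def_u def_v mulnACA -expnD mulnC.
  by rewrite dvdn_mul ?dvdn_exp2l ?dvdn_mulr.
have N_gt0 : 0 < N by move: M_gt0; rewrite defM muln_gt0 => /andP[].
have A_gt0 : 0 < #|A| 
  by have := M_gt0; rewrite -{1}(card_tiling M_gt1 tAB) muln_gt0 => /andP[].
apply: leq_trans (_ : u <= _); last first.
  by rewrite dvdn_leq ?gcdn_gt0 ?A_gt0 // dvdn_gcd u_dvdN def_u dvdn_mulr.
rewrite -(@leq_pmul2r (p ^ (\sum_(s < n) e A s))) ?expn_gt0 ?p_gt0 // -def_u.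
exact: (card_residue_class_le p_gt0 (shift A) x (leqnn n)).
Qed.

End ResidueClasses.

(** * Splitting the fiber of multiples of K = M/p *)

Section FiberSplitting.
Variables (M p n N : nat).
Hypotheses (M_gt1 : 1 < M) (p_pr : prime p) (defM : M = p ^ n.+1 * N).
Implicit Types A B C : {set 'Z_M}.
Let K := p ^ n * N.

Let defMK : M = p * K. Proof. by rewrite defM expnS mulnA. Qed.

Let K_gt0 : 0 < K.
Proof. by have := ltnW M_gt1; rewrite {1}defMK muln_gt0 => /andP[]. Qed.

Lemma dvdn_ZpD d (x y : 'Z_M) : d %| M -> (d %| (x + y)%R) = (d %| x + y).
Proof. by move=> dM; rewrite val_ZpD // /dvdn modn_dvdm. Qed.

Lemma dvdn_ZpB d (x y : 'Z_M) :
  d %| M -> (d %| (x - y)%R) = (nat_of_ord x == y %[mod d]).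
Proof.
move=> dM; rewrite -[in RHS](subrK y x) (val_ZpD M_gt1 (x - y)%R) // modn_dvdm //.
by rewrite -[X in _ == X %[mod _]]add0n eqn_modDr mod0n.
Qed.

(** If p did not divide M/g, the full power of p would lie in g. *)
Lemma dvdn_cofactor g : g %| M -> ~~ (p ^ n.+1 %| g) -> g %| K.
Proof.
case/dvdnP=> h def_hg q_g; have [/dvdnP[h' def_h] | p_h] := boolP (p %| h).
  apply/dvdnP; exists h'; apply/eqP; rewrite -(eqn_pmul2l (prime_gt0 p_pr)).
  by rewrite -defMK def_hg def_h mulnCA mulnA.
case/negP: q_g; rewrite -(@Gauss_dvdr _ h) -?def_hg ?defM ?dvdn_mulr //.
by rewrite coprimeXl // prime_coprime.
Qed.

(** If both congruences fail, the gcds of x and y with M divide K, hence x + y, hence each other;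
    [sands] then forces a = a', a contradiction. *)
Lemma tiling_fiber_dichotomy A B (a b a' b' : 'Z_M) : tiling A B ->
  a \in A -> b \in B -> a' \in A -> b' \in B ->
  K %| ((a + b) - (a' + b'))%R ->
  (nat_of_ord a == a' %[mod p ^ n.+1]) || (nat_of_ord b == b' %[mod p ^ n.+1]).
Proof.
move=> tAB aA bB aA' bB'; have q_M : p ^ n.+1 %| M by rewrite defM dvdn_mulr.
have K_M : K %| M by rewrite defMK dvdn_mull.
rewrite opprD addrACA dvdn_ZpD // -!dvdn_ZpB //.
set x := (a - a')%R; set y := (b - b')%R => K_xy.
apply: contraT; rewrite negb_or => /andP[q_x q_y].
have gcd_dvd (u v : nat) : K %| u + v -> ~~ (p ^ n.+1 %| u) -> gcdn u M %| gcdn v M.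
  move=> K_uv q_u; rewrite dvdn_gcd dvdn_gcdr andbT.
  rewrite -(@dvdn_addr u) ?dvdn_gcdl //; apply: dvdn_trans K_uv.
  apply: dvdn_cofactor (dvdn_gcdr _ _) _; apply: contra q_u => /dvdn_trans-> //.
  exact: dvdn_gcdl.
have eq_gcd : gcdn x M = gcdn y M.
  by apply/eqP; rewrite eqn_dvd !gcd_dvd // addnC.
have [eq_a _] := sands M_gt1 tAB aA bB aA' bB' eq_gcd.
by move: q_x; rewrite /x eq_a subrr dvdn0.
Qed.

Lemma gcdn_fiber_sub (k l : 'I_p) : k != l ->
  gcdn (inZp (k * K) - inZp (l * K) : 'Z_M)%R M = K.
Proof.
move=> neq_kl; have K_M : K %| M by rewrite defMK dvdn_mull.
set z : 'Z_M := (_ - _)%R.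
have [m def_z] : exists m, z = m * K :> nat.
  by apply/dvdnP; rewrite dvdn_ZpB // !val_inZp // !modn_dvdm // !modnMl.
rewrite def_z {1}defMK -muln_gcdl -[RHS]mul1n; congr (_ * _).
apply/eqP; rewrite -/(coprime _ _) coprime_sym prime_coprime //.
apply: contra neq_kl => /(dvdn_mul (dvdnn K)).
rewrite mulnC -defMK mulnC -def_z dvdn_ZpB // !val_inZp // !modn_mod.
by rewrite defMK -!muln_modl eqn_pmul2r // !modn_small.
Qed.

(** Pigeonhole: p summands in a class of fewer than p elements must repeat. A and C are generic so
    that either tile can play either role. *)
Lemma fiber_Div A C (a c : 'I_p -> 'Z_M) x :
  (forall k, a k \in A) -> (forall k, c k \in C) ->
  (forall k, c k + a k = inZp (k * K))%R ->
  (forall k, nat_of_ord (c k) = x %[mod p ^ n.+1]) ->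
  #|residue_class C (p ^ n.+1) x| < p -> K \in Div A.
Proof.
move=> aA cC def_k c_x lt_Cp.
have /injectivePn[k [l neq_kl eq_c]] : ~~ injectiveb c.
  apply: contraL lt_Cp => /injectiveP c_inj; rewrite -leqNgt.
  rewrite -[X in X <= _]card_ord -(card_imset _ c_inj) subset_leq_card //.
  by apply/subsetP=> _ /imsetP[k _ ->]; rewrite inE cC; apply/eqP.
apply/existsP; exists (a k); rewrite aA; apply/existsP; exists (a l); rewrite aA.
by rewrite -(gcdn_fiber_sub neq_kl) -!def_k eq_c opprD addrACA subrr add0r /=.
Qed.

Lemma tiling_fiber_Div A B : tiling A B ->
  maxn (gcdn #|A| N) (gcdn #|B| N) < p -> (K \in Div A) || (K \in Div B).
Proof.
move=> tAB; rewrite gtn_max => /andP[lt_Ap lt_Bp].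
have ltA x := leq_ltn_trans (tiling_card_residue_class M_gt1 x tAB p_pr defM) lt_Ap.
have ltB x :=
  leq_ltn_trans (tiling_card_residue_class M_gt1 x (tiling_sym tAB) p_pr defM) lt_Bp.
have /fin_all_exists[f fP] : forall k : 'I_p, exists ab : 'Z_M * 'Z_M,
    [/\ ab.1 \in A, ab.2 \in B & inZp (k * K) = (ab.1 + ab.2)%R].
  by move=> k; have [ab [abP _]] := tAB (inZp (k * K)); exists ab.
pose a k := (f k).1; pose b k := (f k).2.
have aA k : a k \in A by case: (fP k).
have bB k : b k \in B by case: (fP k).
have def_k k : (a k + b k = inZp (k * K))%R by case: (fP k).
have same k l : (nat_of_ord (a k) == a l %[mod p ^ n.+1])
             || (nat_of_ord (b k) == b l %[mod p ^ n.+1]).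
  apply: (tiling_fiber_dichotomy tAB) => //; rewrite !def_k.
  have K_M : K %| M by rewrite defMK dvdn_mull.
  by rewrite dvdn_ZpB // !val_inZp // !modn_dvdm // !modnMl.
(* Of two equivalence relations whose union is total, one is total. *)
have [/forallP same_a | ] :=
  boolP [forall k, [forall l, nat_of_ord (a k) == a l %[mod p ^ n.+1]]].
  pose k0 := Ordinal (prime_gt0 p_pr).
  rewrite (fiber_Div (x := a k0) bB aA def_k) ?orbT // => k.
  exact/eqP/(forallP (same_a k)).
case/forallPn=> k /forallPn[l diff_a].
rewrite (fiber_Div (x := b k) aA bB) // => m; first by rewrite addrC.
(* Since [a k] and [a l] differ mod p^(n+1), [a m] cannot agree with both, so [b m] agrees with
   [b k] or [b l], which are congruent. *)
have := same m k; have := same m l; have := same k l; rewrite (negPf diff_a) /=.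
move=> /eqP-> /orP[/eqP eq_ml | /eqP-> //] /orP[/eqP eq_mk | /eqP //].
by rewrite -eq_mk eq_ml eqxx in diff_a.
Qed.

End FiberSplitting.

Theorem theorem1p5 (d : nat) (p n : 'I_d.+1 -> nat)
  (p_prime : forall i, prime (p i)) (p_inj : injective p)
  (n_gt0 : forall i, 0 < n i)
  (M : nat) (defM : M = \prod_(i < d.+1) p i ^ n i)
  (A B : {set 'Z_M}) (tAB : tiling A B)
  (p_large : maxn (gcdn #|A| (M %/ p ord_max ^ n ord_max))
                  (gcdn #|B| (M %/ p ord_max ^ n ord_max)) < p ord_max) :
  exists i : 'I_d.+1, M %/ p i \in [predU Div A & Div B].
Proof.
exists ord_max; move: p_large; set q := p _ ^ _; set N := M %/ q => p_large.
have p_pr := p_prime ord_max; have q_gt0 : 0 < q by rewrite expn_gt0 prime_gt0.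
have def_qN : M = q * N by rewrite mulnC divnK // defM (bigD1 ord_max) //= dvdn_mulr.
(* A successor exponent lets M/p be written without division, as p^(n-1) N. *)
have def_n : n ord_max = (n ord_max).-1.+1 by rewrite prednK.
have M_gt0 : 0 < M by rewrite defM prodn_gt0 // => i; rewrite expn_gt0 prime_gt0.
have M_gt1 : 1 < M.
  apply: leq_trans (prime_gt1 p_pr) _; apply: dvdn_leq => //.
  by rewrite def_qN /q def_n expnS -mulnA dvdn_mulr.
rewrite /q def_n in def_qN.
rewrite [X in X \in _](_ : _ = p ord_max ^ (n ord_max).-1 * N).
  exact: (tiling_fiber_Div M_gt1 p_pr def_qN tAB p_large).
by rewrite [in LHS]def_qN expnS -mulnA mulKn // prime_gt0.
Qed.
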